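(* Let $(E,\tau)$ be a linear topological space over $K$. Then $\delta\text{-}(E,\sigma(E,\delta\text{-}E^{*}))^{*}=\delta\text{-}E^{*}$; that is, a linear functional $f:E\to K$ is $\delta$-continuous on $(E,\sigma(E,\delta\text{-}E^{*}))$ if and only if it is $\delta$-continuous on $(E,\tau)$.
   Context: $K$ is $\mathbb{R}$ or $\mathbb{C}$ with its usual topology. A linear topological space over $K$ is a $K$-vector space $E$ with a topology $\tau$ making addition and scalar multiplication continuous (no Hausdorff assumption is stated). In a topological space $X$, a set $U$ is regular open if $U=\operatorname{int}(\operatorname{cl}(U))$; a set $U\subseteq X$ is $\delta$-open if for each $x\in U$ there is a regular open set $P$ with $x\in P\subseteq U$. A map $f:X\to Y$ between topological spaces is $\delta$-continuous if the preimage of every open subset of $Y$ is a $\delta$-open subset of $X$. For a linear topological space $(E,\rho)$, $\delta\text{-}(E,\rho)^{*}$ denotes the set of all $\delta$-continuous linear functionals $(E,\rho)\to K$; $\delta\text{-}E^{*}$ means $\delta\text{-}(E,\tau)^{*}$ for the given topology $\tau$. The delta weak topology $\sigma(E,\delta\text{-}E^{*})$ is the locally convex topology on $E$ generated by the seminorms $p_f(x)=|f(x)|$, $f\in\delta\text{-}E^{*}$; a local base at the null vector consists of the sets $\bigcap_{i=1}^{n}\{x\in E:|f_i(x)|<r_i\}$ with $n\in\mathbb{N}$, $f_i\in\delta\text{-}E^{*}$, $r_i>0$. *)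

(* Defs.v *)
From HB Require Import structures.
From mathcomp Require Import all_boot all_order all_algebra.
From mathcomp Require Import all_classical reals topology tvs.
From mathcomp Require Import complex.

Set Implicit Arguments.
Unset Strict Implicit.
Unset Printing Implicit Defensive.

Import Order.TTheory GRing.Theory Num.Theory.
Local Open Scope classical_set_scope.
Local Open Scope ring_scope.

Definition delta_open (X : topologicalType) (U : set X) : Prop :=
  forall x, U x -> exists P : set X, [/\ regopen P, P x & P `<=` U].

Definition delta_continuous (X Y : topologicalType) (f : X -> Y) : Prop :=
  forall V : set Y, open V -> delta_open (f @^-1` V).

(* [K^o] is [K] as a module over itself, with the topology of the norm. *)
Definition delta_dual (K : numFieldType) (E : topologicalLmodType K) :
    set {linear E -> K^o} :=
  [set f : {linear E -> K^o} | delta_continuous f].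
Arguments delta_dual {K} E.

(* The vector space [E] retopologized with sigma(E, D); the family [D] is a
   phantom parameter that drives the inference of the topology. *)
Definition sigma_topology (K : numFieldType) (E : lmodType K)
  (D : set {linear E -> K^o}) : Type := E.
Arguments sigma_topology {K} E D.

Section sigma_topology.
Context (K : numFieldType) (E : lmodType K) (D : set {linear E -> K^o}).

Local Notation sigma_topology := (sigma_topology E D).

HB.instance Definition _ := GRing.Lmodule.on sigma_topology.

Definition sigma_base (n : nat) (f : 'I_n -> {linear E -> K^o})
    (r : 'I_n -> K) : set E :=
  [set x | forall i, `|f i x| < r i].

(* For K = C, [0 < r i] in the order of C forces [r i] to be real. *)
Definition sigma_nbhs (x : sigma_topology) : set_system sigma_topology :=
  [set A | exists (n : nat) (f : 'I_n -> {linear E -> K^o}) (r : 'I_n -> K),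
    [/\ forall i, D (f i), forall i, 0 < r i &
        forall y : E, sigma_base f r (y - x) -> A y]].

HB.instance Definition _ := hasNbhs.Build sigma_topology sigma_nbhs.

Lemma sigma_nbhs_filter (x : sigma_topology) : ProperFilter (nbhs x).
Proof.
split.
  move=> [n [f [r [_ r0 /(_ x)]]]]; apply => i /=.
  by rewrite subrr linear0 normr0.
split.
- by exists 0%N, (fun=> \0), (fun=> 1); split => // -[].
- move=> A B [n [f [r [Df r0 fA]]]] [m [g [s [Dg s0 gB]]]].
  exists (n + m)%N.
  exists (fun i => match fintype.split i with inl j => f j | inr j => g j end).
  exists (fun i => match fintype.split i with inl j => r j | inr j => s j end).
  split=> [i|i|y xy]; [by case: fintype.split|by case: fintype.split|].
  split; [apply: fA|apply: gB] => i.
    by have := xy (lshift m i); rewrite -[lshift m i]/(unsplit (inl i)) unsplitK.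
  by have := xy (rshift n i); rewrite -[rshift n i]/(unsplit (inr i)) unsplitK.
- move=> A B AB [n [f [r [Df r0 fA]]]]; exists n, f, r; split=> // y xy.
  exact/AB/fA.
Qed.

Lemma sigma_nbhs_singleton (x : sigma_topology) (A : set sigma_topology) :
  nbhs x A -> A x.
Proof.
move=> [n [f [r [_ r0]]]]; apply => i /=.
by rewrite subrr linear0 normr0.
Qed.

Lemma sigma_nbhs_nbhs (x : sigma_topology) (A : set sigma_topology) :
  nbhs x A -> nbhs x (nbhs^~ A).
Proof.
move=> [n [f [r [Df r0 fA]]]]; exists n, f, r; split=> // y xy.
exists n, f, (fun i => r i - `|f i (y - x)|); split=> // [i|z yz].
  by rewrite subr_gt0; exact: xy.
apply: fA => i /=; have := yz i; rewrite /= ltrBrDr; apply: le_lt_trans.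
by rewrite -(subrK y z) -addrA linearD [X in `|X + _|]/= addrK ler_normD.
Qed.

HB.instance Definition _ := Nbhs_isNbhsTopological.Build sigma_topology
  sigma_nbhs_filter sigma_nbhs_singleton sigma_nbhs_nbhs.

Lemma sigma_add_continuous :
  continuous (fun x : sigma_topology * sigma_topology => x.1 + x.2).
Proof.
move=> [x y] A [n [f [r [Df r0 fA]]]] /=.
pose U (z : E) := [set t : sigma_topology | sigma_base f (fun i => r i / 2) (t - z)].
have nU (z : sigma_topology) : nbhs z (U z).
  by exists n, f, (fun i => r i / 2); split=> // i; rewrite divr_gt0.
exists (U x, U y) => [|[a b] [/= Ua Ub]]; first by split; exact: nU.
apply: fA => i /=; rewrite opprD addrACA linearD [r i]splitr.
by rewrite (le_lt_trans (ler_normD _ _))// ltrD.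
Qed.

HB.instance Definition _ :=
  PreTopologicalNmodule_isTopologicalNmodule.Build sigma_topology
    sigma_add_continuous.

Lemma sigma_scale_continuous :
  continuous (fun z : K^o * sigma_topology => z.1 *: z.2).
Proof.
move=> [k x] A [n [f [r [Df r0 fA]]]] /=.
(* |a f t - k f x| <= |a| |f (t - x)| + |a - k| |f x| *)
pose c := `|k| + 1.
have c0 : 0 < c by rewrite ltr_wpDl.
pose d i := r i / 2 / (`|f i x| + 1).
have fx0 i : 0 < `|f i x| + 1 by rewrite ltr_wpDl.
have d0 i : 0 < d i by rewrite !divr_gt0.
exists ([set a : K^o | `|a - k| < 1 /\ forall i, `|a - k| < d i],
        [set t : sigma_topology | sigma_base f (fun i => r i / 2 / c) (t - x)]).
  split=> /=.
    have bk (e : K) : 0 < e -> nbhs (k : K^o) [set a : K^o | `|a - k| < e].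
      by move=> e0; exists e => //= a /=; rewrite distrC.
    apply: (@filterI _ (nbhs (k : K^o))); first exact: bk.
    have := @filter_forall _ _ (fun i (a : K^o) => `|a - k| < d i) (nbhs (k : K^o)).
    by apply=> i; exact: bk.
  exists n, f, (fun i => r i / 2 / c); split=> // i.
  by rewrite !divr_gt0.
move=> [a t] [/= [ak1 akd] ft]; apply: fA => i /=.
have -> : a *: t - k *: x = a *: (t - x) + (a - k) *: x :> E.
  by rewrite scalerBr scalerBl addrA subrK.
rewrite linearD !linearZ /= [r i]splitr (le_lt_trans (ler_normD _ _))// ltrD//.
  rewrite normrM; have := ft i; rewrite /= ltr_pdivlMr// mulrC.
  apply: le_lt_trans; rewrite ler_wpM2r//.
  by rewrite -(subrK k a) addrC (le_trans (ler_normD _ _))// lerD2l ltW.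
rewrite normrM; have := akd i; rewrite ltr_pdivlMr//; apply: le_lt_trans.
by rewrite ler_wpM2l// lerDl.
Qed.

HB.instance Definition _ :=
  TopologicalNmodule_isTopologicalLmodule.Build K sigma_topology
    sigma_scale_continuous.

End sigma_topology.

(* Main.v *)
(** The topology [sigma(E, D)] makes the members of [D] continuous, and a
    continuous map into a regular space is delta-continuous: the interior of
    the preimage of a closed neighborhood is regular open.  Conversely, a
    [sigma]-open set contains, around each of its points [x], a finite
    intersection of sets [{y | |f_i (y - x)| < r_i}] with [f_i] in the delta
    dual of [E]; each of these contains a regular open neighborhood of [x], and
    regular open sets are stable under finite intersections. *)
Require Import Defs.
From mathcomp Require Import all_boot all_order all_algebra.
From mathcomp Require Import all_classical reals topology tvs.
From mathcomp Require Import complex.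

Local Open Scope classical_set_scope.
Local Open Scope ring_scope.

Import Order.TTheory GRing.Theory Num.Theory.

Lemma regopen_open (X : topologicalType) (P : set X) : regopen P -> open P.
Proof. by move=> <-; exact: open_interior. Qed.

Lemma regopenT (X : topologicalType) : regopen [set: X].
Proof. by rewrite /regopen closureT interiorT. Qed.

(** The closure of [P] meet [Q] lies in both closures, and interior commutes with finite
    intersections; conversely an open set lies in the interior of its closure. *)
Lemma regopenI (X : topologicalType) (P Q : set X) :
  regopen P -> regopen Q -> regopen (P `&` Q).
Proof.
move=> rP rQ; apply/seteqP; split.
  rewrite -[X in _ `<=` X `&` _]rP -[X in _ `<=` _ `&` X]rQ -interiorI.
  exact/interiorS/closureI.
rewrite -open_subsetE; first exact: subset_closure.
by apply: openI; exact: regopen_open.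
Qed.

(** Delta-open sets are those in [delta_nbhs] at each of their points; as a filter, it absorbs
    finite intersections. *)
Definition delta_nbhs (X : topologicalType) (x : X) : set_system X :=
  [set A | exists P : set X, [/\ regopen P, P x & P `<=` A]].

Lemma delta_nbhs_filter (X : topologicalType) (x : X) : Filter (delta_nbhs X x).
Proof.
split.
- by exists setT; split=> //; exact: regopenT.
- move=> A B [P [rP Px PA]] [Q [rQ Qx QB]]; exists (P `&` Q).
  by split; [exact: regopenI|split|exact: setISS].
- by move=> A B AB [P [rP Px PA]]; exists P; split=> //; exact: subset_trans AB.
Qed.

Lemma delta_open_open (X : topologicalType) (U : set X) :
  delta_open U -> open U.
Proof.
move=> dU; rewrite openE => x /dU [P [/regopen_open oP Px PU]].
by apply: (filterS PU); exact: open_nbhs_nbhs.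
Qed.

Lemma delta_continuous_continuous (X Y : topologicalType) (f : X -> Y) :
  delta_continuous f -> continuous f.
Proof. by move=> df; apply/continuousP => V /df; exact: delta_open_open. Qed.

Lemma continuous_delta_continuous (X Y : topologicalType) (f : X -> Y) :
  regular_space Y -> continuous f -> delta_continuous f.
Proof.
move=> regY cf V oV x Vfx.
have [W nW WV] : filter_from (nbhs (f x)) closure V.
  by apply: regY; exact: open_nbhs_nbhs.
exists (f @^-1` closure W)°; split.
- apply: interior_closed_regopen.
  by apply: closed_comp => [y _|]; [exact: cf|exact: closed_closure].
- by apply: cf; apply: filterS nW; exact: subset_closure.
- by move=> y /interior_subset; exact: WV.
Qed.

Lemma nbhs_ballo (K : numFieldType) (a : K^o) (e : K) :
  0 < e -> nbhs a [set b : K^o | `|b - a| < e].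
Proof. by move=> e0; exists e => //= b /=; rewrite distrC. Qed.

Lemma sigma_continuous (K : numFieldType) (E : lmodType K)
    (D : set {linear E -> K^o}) (f : {linear E -> K^o}) :
  D f -> continuous (f : sigma_topology E D -> K^o).
Proof.
move=> Df x A [e /= e0 eA]; exists 1%N, (fun=> f), (fun=> e); split=> // y.
by move=> /(_ ord0) /=; rewrite linearB distrC => /eA.
Qed.

Lemma delta_dual_nbhs (K : numFieldType) (E : topologicalLmodType K)
    (f : {linear E -> K^o}) (x : E) (r : K) :
  delta_dual E f -> 0 < r -> delta_nbhs E x [set y | `|f (y - x)| < r].
Proof.
move=> df r0.
(* Delta-continuity asks for an open set, so the interior of the ball replaces the ball. *)
have [|P [rP Px PV]] := df _ (open_interior [set b : K^o | `|b - f x| < r]) x.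
  exact: nbhs_ballo.
by exists P; split=> // y /PV /interior_subset /=; rewrite linearB.
Qed.

Theorem theorem3p8 (R : realType) (K : numFieldType)
    (hK : K = R :> numFieldType \/ K = R[i] :> numFieldType)
    (E : topologicalLmodType K) :
  delta_dual (sigma_topology E (delta_dual E)) = delta_dual E.
Proof.
apply/seteqP; split=> f.
  move=> /delta_continuous_continuous cf V oV x Vfx.
  have [n [g [r [Dg r0 gV]]]] : nbhs (x : sigma_topology E (delta_dual E))
    (f @^-1` V) by apply: cf; exact: open_nbhs_nbhs.
  have Fx := delta_nbhs_filter E x.
  (* The index type ['I_n] is finite, so the conditions on all [g i] hold together on one regular
     open set around [x]. *)
  have := filter_forall Fx
    (fun i => delta_dual_nbhs K E (g i) x (r i) (Dg i) (r0 i)).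
  by apply: filterS => y; exact: gV.
move=> Df; apply: continuous_delta_continuous; last exact: sigma_continuous.
(* The topology of [K^o] comes from a uniformity, hence is regular. *)
exact: uniform_regular.
Qed.
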